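(* The image of $(k_p)_{p \in \mathbb{P}} \in \mathbb{Z}^{\mathbb{P}}$ in $\mathscr{A}$ is transcendental over $\mathbb{Q}$.
   Context: $\mathbb{P}$ denotes the set of prime numbers; $\mathbb{F}_p = \mathbb{Z}/p\mathbb{Z}$. For $p \in \mathbb{P}$, $k_p$ denotes the greatest odd divisor of $p-1$. The ring $\mathscr{A}$ of integers modulo infinitely large primes is $\mathscr{A} = \prod_{p \in \mathbb{P}} \mathbb{F}_p \big/ \bigoplus_{p \in \mathbb{P}} \mathbb{F}_p$, a commutative $\mathbb{Q}$-algebra (each nonzero integer is invertible modulo all but finitely many primes). The image in $\mathscr{A}$ of a sequence of integers $(a(p))_{p \in \mathbb{P}}$ is the class of $(a(p) \bmod p)_{p \in \mathbb{P}}$. An element $\alpha \in \mathscr{A}$ is (naively) algebraic over $\mathbb{Q}$ if there is a nonzero $g \in \mathbb{Q}[x]$ with $g(\alpha) = 0$ in $\mathscr{A}$, and (naively) transcendental over $\mathbb{Q}$ otherwise. *)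

(* Defs.v *)
From HB Require Import structures.
From mathcomp Require Import all_boot all_order all_algebra.
From mathcomp Require Import ring_quotient ring boolp classical_sets cardinality.

Set Implicit Arguments.
Unset Strict Implicit.
Unset Printing Implicit Defensive.

Import GRing.Theory.
Local Open Scope ring_scope.
Local Open Scope quotient_scope.

Definition primeT := {p : nat | prime p}.

Definition prodF := forall p : primeT, 'F_(val p).

HB.instance Definition _ := Choice.on prodF.

Lemma prodFP (x y : prodF) : (forall p, x p = y p) -> x = y.
Proof. exact: functional_extensionality_dep. Qed.

Definition prodF_add (x y : prodF) : prodF := fun p => x p + y p.
Definition prodF_opp (x : prodF) : prodF := fun p => - x p.
Definition prodF_mul (x y : prodF) : prodF := fun p => x p * y p.

Fact prodF_addA : associative prodF_add.
Proof. by move=> x y z; apply: prodFP => p; rewrite /prodF_add addrA. Qed.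
Fact prodF_addC : commutative prodF_add.
Proof. by move=> x y; apply: prodFP => p; rewrite /prodF_add addrC. Qed.
Fact prodF_add0 : left_id (fun p => 0) prodF_add.
Proof. by move=> x; apply: prodFP => p; rewrite /prodF_add add0r. Qed.
Fact prodF_addN : left_inverse (fun p => 0) prodF_opp prodF_add.
Proof. by move=> x; apply: prodFP => p; rewrite /prodF_add /prodF_opp addNr. Qed.
HB.instance Definition _ := GRing.isZmodule.Build prodF
  prodF_addA prodF_addC prodF_add0 prodF_addN.

Fact prodF_mulA : associative prodF_mul.
Proof. by move=> x y z; apply: prodFP => p; rewrite /prodF_mul mulrA. Qed.
Fact prodF_mulC : commutative prodF_mul.
Proof. by move=> x y; apply: prodFP => p; rewrite /prodF_mul mulrC. Qed.
Fact prodF_mul1 : left_id (fun p => 1) prodF_mul.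
Proof. by move=> x; apply: prodFP => p; rewrite /prodF_mul mul1r. Qed.
Fact prodF_mulDl : left_distributive prodF_mul +%R.
Proof. by move=> x y z; apply: prodFP => p; apply: mulrDl. Qed.
Fact prodF_1neq0 : (fun p => 1) != 0 :> prodF.
Proof.
apply/eqP => /(congr1 (fun x : prodF => x (exist _ 2 isT))) /eqP.
by rewrite oner_eq0.
Qed.
HB.instance Definition _ := GRing.Zmodule_isComNzRing.Build prodF
  prodF_mulA prodF_mulC prodF_mul1 prodF_mulDl prodF_1neq0.

Lemma prodF_addE (x y : prodF) p : (x + y) p = x p + y p. Proof. by []. Qed.
Lemma prodF_oppE (x : prodF) p : (- x) p = - x p. Proof. by []. Qed.
Lemma prodF_mulE (x y : prodF) p : (x * y) p = x p * y p. Proof. by []. Qed.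
Lemma prodF_0E p : (0 : prodF) p = 0. Proof. by []. Qed.
Lemma prodF_1E p : (1 : prodF) p = 1. Proof. by []. Qed.

Definition sumF : {pred prodF} :=
  fun x => `[< finite_set [set p : primeT | x p != 0]%classic >].

Lemma sumFP (x : prodF) :
  reflect (exists n, forall p : primeT, (n <= val p)%N -> x p = 0) (x \in sumF).
Proof.
apply: (iffP (asboolP _)) => [/finite_seqP[s sE]|[n xn0]].
  exists (\max_(p <- s) val p).+1 => p lt_p; apply/eqP/negPn/negP => xp0.
  have : [set p : primeT | x p != 0]%classic p by [].
  rewrite sE => ps; move: lt_p; rewrite ltnNge => /negP; apply.
  exact: (@leq_bigmax_seq _ s xpredT (fun p => val p)).
apply/finite_seqP; exists [seq p <- pmap insub (iota 0 n) | x p != 0].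
rewrite predeqE => p /=; rewrite mem_filter; split=> [xp0|/andP[]//].
rewrite xp0 mem_pmap_sub mem_iota add0n /= ltnNge; apply/negP => /xn0 xp.
by rewrite xp eqxx in xp0.
Qed.

Fact sumF_ideal : idealr_closed sumF.
Proof.
split=> [||x u v /sumFP[m um] /sumFP[n vn]].
- by apply/sumFP; exists 0%N.
- apply/negP => /sumFP[n h]; have [p lt_np p_pr] := prime_above n.
  by have /eqP := h (exist _ p p_pr) (ltnW lt_np); rewrite oner_eq0.
- apply/sumFP; exists (maxn m n) => p; rewrite geq_max => /andP[mp np].
  by rewrite prodF_addE prodF_mulE um // vn // mulr0 addr0.
Qed.
HB.instance Definition _ := isIdealr.Build prodF sumF sumF_ideal.

Definition ringA := {ideal_quot sumF}.
HB.instance Definition _ := GRing.ComNzRing.on ringA.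

Lemma ringA_eqP (x y : prodF) :
  reflect (exists n, forall p : primeT, (n <= val p)%N -> x p = y p)
          (\pi_ringA x == \pi_ringA y).
Proof.
rewrite -Quotient.idealrBE; apply: (iffP (sumFP _)) => -[n h];
  exists n => p /h; rewrite prodF_addE prodF_oppE.
  by move/eqP; rewrite subr_eq0 => /eqP.
by move->; rewrite subrr.
Qed.

Lemma intr_Fp_neq0 (p : primeT) (z : int) :
  z != 0 -> (`|z| < val p)%N -> z%:~R != 0 :> 'F_(val p).
Proof.
move=> z0 ltzp; have chF := pchar_Fp (valP p).
have h n : (0 < n < val p)%N -> n%:~R != 0 :> 'F_(val p).
  by case/andP=> n0 np; rewrite -pmulrn -(dvdn_pcharf chF) gtnNdvd.
case: z z0 ltzp => n z0 np; rewrite ?NegzE ?mulrNz ?oppr_eq0 h //.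
by rewrite lt0n np andbT.
Qed.

Lemma ratr_mulz (F : fieldType) (q : rat) (a b : int) :
  (denq q)%:~R != 0 :> F -> q * b%:~R = a%:~R -> ratr q * b%:~R = a%:~R :> F.
Proof.
move=> d0 qba; rewrite /ratr mulrAC; apply: canLR (mulfK d0) _.
rewrite -!intrM; congr _%:~R; apply: (@intr_inj rat).
by rewrite !intrM -qba numqE mulrAC.
Qed.

Lemma ratr_add (F : fieldType) (q r : rat) :
  (denq q)%:~R != 0 :> F -> (denq r)%:~R != 0 :> F ->
  (denq (q + r))%:~R != 0 :> F -> ratr (q + r) = ratr q + ratr r :> F.
Proof.
move=> q0 r0 s0; have d0 := mulf_neq0 q0 r0; apply: (mulIf d0).
rewrite -intrM (@ratr_mulz _ _ (numq q * denq r + numq r * denq q)) //.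
  by rewrite /ratr intrD !intrM; field; rewrite q0 r0.
by rewrite intrD !intrM !numqE; ring.
Qed.

Lemma ratr_mul (F : fieldType) (q r : rat) :
  (denq q)%:~R != 0 :> F -> (denq r)%:~R != 0 :> F ->
  (denq (q * r))%:~R != 0 :> F -> ratr (q * r) = ratr q * ratr r :> F.
Proof.
move=> q0 r0 s0; have d0 := mulf_neq0 q0 r0; apply: (mulIf d0).
rewrite -intrM (@ratr_mulz _ _ (numq q * numq r)) //.
  by rewrite /ratr !intrM; field; rewrite q0 r0.
by rewrite !intrM !numqE; ring.
Qed.

(* [ratr q : 'F_p] is the reduction of [q] only when [p] does not divide
   [denq q]; the finitely many other primes do not matter in [ringA]. *)
Definition ratA (q : rat) : ringA := \pi_ringA (fun p : primeT => ratr q).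

Lemma den_Fp_neq0 (q : rat) (p : primeT) :
  (`|denq q| < val p)%N -> (denq q)%:~R != 0 :> 'F_(val p).
Proof. exact/intr_Fp_neq0/denq_neq0. Qed.

Fact ratA_add : {morph ratA : q r / q + r}.
Proof.
move=> q r; rewrite -rmorphD; apply/eqP/ringA_eqP.
exists (maxn `|denq q| (maxn `|denq r| `|denq (q + r)|)).+1 => p.
rewrite !gtn_max => /and3P[qp rp sp].
by rewrite prodF_addE ratr_add ?den_Fp_neq0.
Qed.

Fact ratA_mul : {morph ratA : q r / q * r}.
Proof.
move=> q r; rewrite -rmorphM; apply/eqP/ringA_eqP.
exists (maxn `|denq q| (maxn `|denq r| `|denq (q * r)|)).+1 => p.
rewrite !gtn_max => /and3P[qp rp sp].
by rewrite prodF_mulE ratr_mul ?den_Fp_neq0.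
Qed.

Fact ratA_1 : ratA 1 = 1.
Proof.
rewrite -[RHS](rmorph1 (\pi_ringA)); apply/eqP/ringA_eqP; exists 0%N => p _.
exact: (ratr_int _ 1).
Qed.

Definition scaleA (q : rat) (x : ringA) : ringA := ratA q * x.

Fact scaleA_A q r x : scaleA q (scaleA r x) = scaleA (q * r) x.
Proof. by rewrite /scaleA ratA_mul mulrA. Qed.
Fact scaleA_1 : left_id 1 scaleA.
Proof. by move=> x; rewrite /scaleA ratA_1 mul1r. Qed.
Fact scaleA_Dr : right_distributive scaleA +%R.
Proof. by move=> q x y; apply: mulrDr. Qed.
Fact scaleA_Dl x : {morph scaleA^~ x : q r / q + r}.
Proof. by move=> q r; rewrite /scaleA ratA_add mulrDl. Qed.
HB.instance Definition _ := GRing.Zmodule_isLmodule.Build rat ringA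
  scaleA_A scaleA_1 scaleA_Dr scaleA_Dl.

Fact scaleA_Al (q : rat) (x y : ringA) : q *: (x * y) = q *: x * y.
Proof. exact: mulrA. Qed.
HB.instance Definition _ := GRing.Lmodule_isLalgebra.Build rat ringA scaleA_Al.
HB.instance Definition _ := GRing.Lalgebra_isComAlgebra.Build rat ringA.

Definition algebraic (A : comAlgType rat) (a : A) : Prop :=
  exists g : {poly rat}, g != 0 /\ horner_alg a g = 0.

Definition transcendental (A : comAlgType rat) (a : A) : Prop :=
  ~ algebraic a.

Definition imageA (a : primeT -> int) : ringA :=
  \pi_ringA (fun p : primeT => (a p)%:~R).

Definition greatest_odd_divisor (n : nat) : nat :=
  \max_(d <- divisors n | odd d) d.

Definition k_ (p : primeT) : int := greatest_odd_divisor (val p).-1.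

(* Main.v *)
Require Import Defs.
From mathcomp Require Import all_boot all_order all_algebra.
From mathcomp Require Import finfield ring_quotient boolp zify ring.

(** If [p - 1 = 2 ^ e * m] with [m] odd, then [k_p = m] is congruent to
    [- 2 ^ -e] modulo [p].  For each [e >= 2] infinitely many primes have this
    exact [e], so a rational polynomial annihilating the class of [k_p] vanishes
    at [- 2 ^ -e] for all these [e], hence is zero.

    To get such a prime above a bound, take [n = 3] modulo 8 divisible by all
    small odd primes.  Then [(n ^ (2 ^ (e - 1)) + 1) / 2] is congruent to
    [1 + 2 ^ e] modulo [2 ^ (e + 1)], and each of its prime divisors is
    congruent to 1 modulo [2 ^ e]; so one of them is not congruent to 1 modulo
    [2 ^ (e + 1)]. *)

Set Implicit Arguments.
Unset Strict Implicit.
Unset Printing Implicit Defensive.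

Import GRing.Theory Num.Theory.
Local Open Scope ring_scope.

Lemma eqn1_mod_prime_divisors (d N : nat) : (0 < N)%N ->
  (forall p, prime p -> (p %| N)%N -> p = 1 %[mod d])%N -> (N = 1 %[mod d])%N.
Proof.
elim/ltn_ind: N => N IH N_gt0 Nd.
have [N_le1|N_gt1] := leqP N 1; first by have -> : N = 1%N by lia.
have p_pr := pdiv_prime N_gt1; have pN := pdiv_dvd N.
have p_gt1 := prime_gt1 p_pr.
rewrite -(divnK pN) -modnMmr (Nd _ p_pr pN) modnMmr muln1; apply: IH.
- by rewrite ltn_Pdiv.
- by rewrite divn_gt0 ?pdiv_gt0 // dvdn_leq.
by move=> q q_pr qN; apply: Nd; rewrite // (dvdn_trans qN) // dvdn_div.
Qed.

(** Squaring [1 + 2 ^ k.+3 * t] gives [1 + 2 ^ k.+4 * (t + 2 ^ k.+2 * t ^ 2)], whose cofactor is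
    again odd. *)
Lemma expn_pow2_mod8 (n k : nat) : (n %% 8 = 3)%N ->
  exists2 t, odd t & (n ^ (2 ^ k.+1) = 1 + 2 ^ k.+3 * t)%N.
Proof.
move=> n3; elim: k => [|k [t t_odd IH]].
  (* With [q = n %/ 8], [(8 * q + 3) ^ 2 = 1 + 8 * (8 * q ^ 2 + 6 * q + 1)]. *)
  exists (8 * (n %/ 8) ^ 2 + 6 * (n %/ 8) + 1)%N; first by lia.
  rewrite {1}(divn_eq n 8) n3; set q := (n %/ 8)%N.
  by rewrite !expnS !expn0; ring.
exists (t + 2 * (2 ^ k.+1 * t ^ 2))%N; first by rewrite oddD oddM addbF.
rewrite expnS mulnC expnM IH !expnS expn0; ring.
Qed.

(** Since its [2 ^ k]-th power is -1, which is not 1, [n] has order exactly [2 ^ k.+1] modulo [p];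
    by Fermat this order divides [p.-1]. *)
Lemma expr_eqN1_dvd_pred (p n k : nat) : prime p -> (2 < p)%N ->
  (p %| n ^ (2 ^ k) + 1)%N -> (2 ^ k.+1 %| p.-1)%N.
Proof.
move=> p_pr p_gt2 pn; have chp := pchar_Fp p_pr.
pose x : 'F_p := n%:R.
have xN1 : x ^+ (2 ^ k) = -1.
  by apply/eqP; rewrite -addr_eq0 -natrX natr1 -addn1 -(dvdn_pcharf chp).
have x1 : x ^+ (2 ^ k.+1) = 1 by rewrite expnS mulnC exprM xN1 sqrrN expr1n.
have N1_neq1 : (-1 : 'F_p) != 1.
  rewrite -subr_eq0 -opprD oppr_eq0 -(natrD _ 1 1) -(dvdn_pcharf chp).
  by apply/negP => /dvdn_leq; lia.
have [|m m_prim m_dvd] := @prim_order_exists _ _ _ _ x1.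
  by rewrite expn_gt0.
have /(dvdn_pfactor _ _ (isT : prime 2))[j le_jk mE] := m_dvd.
have jE : j = k.+1.
  apply/eqP; rewrite eqn_leq le_jk ltnNge; apply: contra N1_neq1 => le_jk'.
  by rewrite -xN1 -(prim_order_dvd m_prim) mE dvdn_exp2l.
rewrite -jE -mE (prim_order_dvd m_prim).
have x_neq0 : x != 0.
  by apply: contra_eq_neq x1 => ->; rewrite expr0n expn_eq0 eq_sym oner_eq0.
have := expf_card x; rewrite card_Fp // => xp.
apply/eqP/(mulfI x_neq0); rewrite mulr1 -exprS prednK //.
exact: prime_gt0.
Qed.

Lemma prime_above_exact_val2 (k B : nat) : exists2 p, prime p &
  (B < p)%N /\ exists2 m, odd m & (p.-1 = 2 ^ k.+2 * m)%N.
Proof.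
(* The factors 1, 3, ..., [2 * B - 1] include every odd prime up to [B]. *)
pose M := (\prod_(i < B) (2 * i + 1))%N.
have M_odd : odd M.
  by apply: (big_ind odd) => // [a b|i _]; rewrite ?oddM ?oddD ?oddM; lia.
(* An odd square is 1 modulo 8, so the factor 3 gives the required residue. *)
pose n := (3 * M ^ 2)%N.
have n3 : (n %% 8 = 3)%N.
  have [q Mq] : exists q, M = (2 * q + 1)%N by exists M./2; lia.
  rewrite /n Mq; have [r] : exists r, (q * q.+1 = 2 * r)%N.
    by exists (q * q.+1)./2; have := oddM q q.+1; rewrite /= andbN; lia.
  rewrite !expnS expn0 => qr; nia.
have [t t_odd nt] := expn_pow2_mod8 k n3.
pose N := (1 + 2 ^ k.+2 * t)%N.
have nN : (n ^ (2 ^ k.+1) + 1 = 2 * N)%N by rewrite nt /N !expnS; ring.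
have N_odd : odd N by rewrite /N oddD oddM oddX.
have p_dvd p : prime p -> (p %| N)%N -> (2 ^ k.+2 %| p.-1)%N.
  move=> p_pr pN; apply: (@expr_eqN1_dvd_pred _ n) => //.
    have := dvdn_odd pN N_odd; have := prime_gt1 p_pr.
    by case: p {p_pr pN} => [|[|[|]]].
  by rewrite nN dvdn_mull.
have [/existsP[p /and3P[p_pr pN pk]]|no_p] :=
  boolP [exists p : 'I_N.+1, [&& prime p, p %| N & p != 1 %[mod 2 ^ k.+3]]]%N;
  last first.
  (* If all prime divisors of [N] are 1 modulo [2 ^ k.+3], so is [N], and then [t] is even. *)
  have : (N = 1 %[mod 2 ^ k.+3])%N.
    apply: eqn1_mod_prime_divisors => [|p p_pr pN]; first by rewrite /N.
    have ltpN : (p < N.+1)%N by rewrite ltnS dvdn_leq.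
    move/existsPn/(_ (Ordinal ltpN)): no_p.
    by rewrite /= p_pr pN /= negbK => /eqP.
  move/eqP; rewrite /N -{2}(addn0 1%N) eqn_modDl mod0n.
  rewrite -/(dvdn _ _) expnS mulnC dvdn_pmul2l ?expn_gt0 //.
  by rewrite dvdn2 t_odd.
exists p => //; split.
  (* A prime [p <= B] would divide both [n ^ (2 ^ k.+1)] and its successor. *)
  rewrite ltnNge; apply/negP => le_pB.
  have p_odd := dvdn_odd pN N_odd.
  have lt_pB : (p./2 < B)%N by have := prime_gt1 p_pr; lia.
  have pM : (p %| M)%N.
    rewrite /M (bigD1 (Ordinal lt_pB)) //= dvdn_mulr //.
    by rewrite mul2n addn1 -[X in (X %| _)%N]odd_double_half p_odd.
  have pn : (p %| n ^ (2 ^ k.+1))%N.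
    by rewrite dvdn_exp ?expn_gt0 // dvdn_mull // dvdn_exp.
  have : (p %| n ^ (2 ^ k.+1) + 1)%N by rewrite nN dvdn_mull.
  by rewrite dvdn_addr // dvdn1 => /eqP p1; rewrite p1 in p_pr.
have /dvdnP[m pm] := p_dvd p p_pr pN.
exists m; last by rewrite mulnC.
(* An even [m] would make [p] congruent to 1 modulo [2 ^ k.+3]. *)
apply: contraR pk => m_even.
have -> : (p : nat) = (p.-1 + 1)%N by rewrite addn1 prednK ?prime_gt0.
rewrite pm -[X in (_ == X %% _)%N]add0n eqn_modDr mod0n -/(dvdn _ _).
by rewrite expnS dvdn_pmul2r ?expn_gt0 // dvdn2.
Qed.

Lemma greatest_odd_divisorE (e m : nat) : odd m ->
  greatest_odd_divisor (2 ^ e * m) = m.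
Proof.
move=> m_odd; have m_gt0 := odd_gt0 m_odd.
have em_gt0 : (0 < 2 ^ e * m)%N by rewrite muln_gt0 expn_gt0.
apply/eqP; rewrite eqn_leq /greatest_odd_divisor; apply/andP; split.
  apply/bigmax_leqP_seq => d; rewrite -dvdn_divisors // => dm d_odd.
  apply: dvdn_leq => //; move: dm; rewrite Gauss_dvdr //.
  by rewrite coprimeXr // coprimen2.
by apply: leq_bigmax_seq; rewrite // -dvdn_divisors // dvdn_mull.
Qed.

Lemma imageA_eq0P (a : primeT -> int) :
  imageA a = 0 -> exists n, forall p : primeT, (n <= val p)%N ->
    (a p)%:~R = 0 :> 'F_(val p).
Proof. by rewrite -[0](rmorph0 (\pi_ringA)%qT) => /eqP/ringA_eqP. Qed.

Lemma imageA_add (a b : primeT -> int) :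
  imageA (fun p => a p + b p) = imageA a + imageA b.
Proof.
by rewrite -rmorphD; congr (\pi_ringA _)%qT; apply: prodFP => p; rewrite intrD.
Qed.

Lemma imageA_mul (a b : primeT -> int) :
  imageA (fun p => a p * b p) = imageA a * imageA b.
Proof.
by rewrite -rmorphM; congr (\pi_ringA _)%qT; apply: prodFP => p; rewrite intrM.
Qed.

Lemma imageA_cst (c : int) : imageA (fun=> c) = c%:~R%:A.
Proof.
rewrite [RHS]mulr1; congr (\pi_ringA _)%qT; apply: prodFP => p.
by rewrite ratr_int.
Qed.

Lemma horner_alg_imageA (a : primeT -> int) (h : {poly int}) :
  horner_alg (imageA a) (map_poly intr h) = imageA (fun p => h.[a p]).
Proof.
elim/poly_ind: h => [|h c IH].
  rewrite !rmorph0 -(scale0r 1) -(imageA_cst 0).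
  by congr imageA; apply/funext => p; rewrite horner0.
rewrite rmorphD rmorphM /= map_polyX map_polyC rmorphD rmorphM /=.
rewrite horner_algX horner_algC IH -imageA_cst -imageA_mul -imageA_add.
by congr imageA; apply/funext => p; rewrite hornerMXaddC.
Qed.

(** This is [y ^ size h] times the value of [h] at [-1/y], written without division so that it is an
    integer. *)
Definition scaled_horner_opp_inv (h : {poly int}) (y : nat) : int :=
  \sum_(i < size h) h`_i * (-1) ^+ i * (y ^ (size h - i))%:Z.

(** The field is arbitrary so that a single integer governs both the value of [h] at [k_p] in ['F_p]
    and its value at [-1/y] in [rat]. *)
Lemma scaled_horner_opp_invE (F : fieldType) (h : {poly int}) (y : nat) (x : F) :
  y%:R * x = -1 ->
  (scaled_horner_opp_inv h y)%:~R = y%:R ^+ size h * (map_poly intr h).[x].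
Proof.
move=> yx; rewrite (@horner_coef_wide _ (size h)) ?size_poly //.
rewrite rmorph_sum mulr_sumr /=; apply: eq_bigr => i _.
rewrite coef_map /= !intrM rmorphXn /= rmorphN1 -yx -pmulrn natrX exprMn.
have -> : y%:R ^+ size h = y%:R ^+ (size h - i) * y%:R ^+ i :> F.
  by rewrite -exprD subnK // ltnW.
by ring.
Qed.

Theorem theorem1p8 : transcendental (imageA k_).
Proof.
case=> g [g_neq0 ga].
have [h [c c_neq0 gE]] := rat_poly_scale g.
set hQ := map_poly _ h in gE.
have hQ_neq0 : hQ != 0 by apply: contraNneq g_neq0 => h0; rewrite gE h0 scaler0.
have /imageA_eq0P[B hB] : imageA (fun p => h.[k_ p]) = 0.
  rewrite -horner_alg_imageA -/hQ.
  have -> : hQ = c%:~R *: g by rewrite gE scalerA mulfV ?intr_eq0 // scale1r.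
  by rewrite -mul_polyC rmorphM /= ga mulr0.
pose r k : rat := - (2 ^ k.+2)%:R^-1.
have r_root k : root hQ (r k).
  have y_neq0 : (2 ^ k.+2)%:R != 0 :> rat by rewrite pnatr_eq0 expn_eq0.
  pose H := scaled_horner_opp_inv h (2 ^ k.+2).
  (* [H] does not depend on the prime, and it vanishes modulo some prime larger than its absolute
     value. *)
  have H0 : H = 0.
    apply/eqP; apply: contraT => H_neq0.
    have [p p_pr [p_gt [m m_odd pm]]] :=
      prime_above_exact_val2 k (maxn B `|H|%N).
    move: p_gt; rewrite gtn_max => /andP[Bp Hp].
    pose P : primeT := exist _ p p_pr.
    have kP : k_ P = m by rewrite /k_ /= pm greatest_odd_divisorE.
    have /negP[] := @intr_Fp_neq0 P H H_neq0 Hp; apply/eqP.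
    rewrite (@scaled_horner_opp_invE _ _ _ (m%:Z%:~R)).
      have := hB P (ltnW Bp); rewrite kP /= => hP.
      by rewrite horner_map /= hP mulr0.
    (* In ['F_p], [2 ^ k.+2 * m = p - 1 = -1]. *)
    rewrite -pmulrn -natrM -pm; apply/eqP.
    rewrite -addr_eq0 natr1 prednK ?prime_gt0 //.
    by rewrite -(dvdn_pcharf (pchar_Fp p_pr)).
  have := @scaled_horner_opp_invE rat h (2 ^ k.+2) (r k).
  rewrite -/H H0 mulrN mulfV // => /(_ erefl)/esym/eqP.
  by rewrite mulf_eq0 expf_eq0 (negPf y_neq0) andbF.
have r_inj : injective r.
  by move=> i j /oppr_inj/invr_inj/eqP; rewrite eqr_nat eqn_exp2l // => /eqP[].
(* [size hQ] distinct roots are one more than the degree allows. *)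
have rs_roots : all (root hQ) (map r (iota 0 (size hQ))).
  by apply/allP => _ /mapP[i _ ->].
have := max_poly_roots hQ_neq0 rs_roots.
by rewrite size_map size_iota ltnn (map_inj_uniq r_inj) iota_uniq => /(_ isT).
Qed.
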